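(* Consider a $W$-tier product offering problem with candidate sets $X_1,\dots,X_W$, product profits $r_i$ and product valuations $0\le v_i<1$. Denote by $\mathbf{S}^*=(S_1^*,S_2^*,\dots,S_W^* )$ and $\hat{\mathbf{S}}^*=(\hat S_1^*,\hat S_2^*,\dots,\hat S_W^* )$ the optimal recommendation before and after, respectively, including a new product $m$ with profit $r_m$ to a candidate set. Define $\mathbf{S}^*_j=(S^*_j,S^*_{j+1},\dots,S^*_W)$ and likewise $\hat{\mathbf{S}}^*_j=(\hat S^*_j,\hat S^*_{j+1},\dots,\hat S^*_W)$. Then the following properties hold. 1. $E[R(\hat{\mathbf{S}}^*_j)]\ge E[R(\hat{\mathbf{S}}^*_{j+1})]$ for any $j=1,\dots,W-1$. 2. If $E[R(\mathbf{S}^*_j)]<r_m<E[R(\mathbf{S}^*_{j-1})]$ for some $j$, then $m\in\hat{\mathbf{S}}^*$ (that is, $m$ is offered in some tier of $\hat{\mathbf{S}}^*$), but $m\notin\hat S_1^*\cup\hat S_2^*\cup\cdots\cup\hat S_{j-1}^*$. 3. If $r_m<E[R(S_W^* )]$, then $m\notin\hat{\mathbf{S}}^*$ (that is, $m$ is offered in no tier of $\hat{\mathbf{S}}^*$).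
   Context: Under the sequential multinomial logit model with tiers $(S_j,\dots,S_W)$, a customer considers the tiers in order; upon reaching tier $S_k$ she buys $i\in S_k$ with probability $v_i/(1+\sum_{l\in S_k}v_l)$ and otherwise (with probability $1/(1+\sum_{l\in S_k}v_l)$) moves on to the next tier, leaving without purchase after tier $W$. The seller earns profit $r_i$ when $i$ is bought. Thus the expected profit is $$E[R((S_j,\dots,S_W))]=\sum_{k=j}^{W}\Big(\prod_{l=j}^{k-1}\frac{1}{1+\sum_{i\in S_l}v_i}\Big)\frac{\sum_{i\in S_k}r_iv_i}{1+\sum_{i\in S_k}v_i},$$ and in particular $E[R(S_W)]=\frac{\sum_{i\in S_W}r_iv_i}{1+\sum_{i\in S_W}v_i}$. An optimal recommendation maximizes $E[R((S_1,\dots,S_W))]$ over all $S_k\subseteq X_k$, $k=1,\dots,W$. The candidate sets $X_k$ are pre-determined and need not be mutually exclusive.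
   Formalization: In part 2, that m is offered is claimed only if m was added to the candidate set of some tier k ≥ j (2 ≤ j ≤ W); if v_m = 0, parts 2 and 3 are claimed for some optimal recommendation after including m rather than for every one. Without these changes the claims fail. *)

(* Defs.v *)
From HB Require Import structures.
From mathcomp Require Import all_boot all_order all_algebra.

Set Implicit Arguments.
Unset Strict Implicit.
Unset Printing Implicit Defensive.

Import Order.TTheory GRing.Theory Num.Theory.

Local Open Scope ring_scope.

(* Tiers are numbered 1, ..., W.  A family of candidate sets and a
   recommendation are both functions nat -> {set T}, of which only the values
   at 1, ..., W matter. *)

Section SequentialMNL.

Variables (R : realFieldType) (T : finType) (W : nat) (v r : T -> R).

Definition no_purchase (A : {set T}) : R := 1 / (1 + \sum_(i in A) v i).

Definition tier_profit (A : {set T}) : R :=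
  (\sum_(i in A) r i * v i) / (1 + \sum_(i in A) v i).

(* E[R((S_j, ..., S_W))] *)
Definition expected_profit (S : nat -> {set T}) (j : nat) : R :=
  \sum_(j <= k < W.+1)
    (\prod_(j <= l < k) no_purchase (S l)) * tier_profit (S k).

Definition feasible (X S : nat -> {set T}) : Prop :=
  forall k : nat, (1 <= k <= W)%N -> S k \subset X k.

Definition optimal (X S : nat -> {set T}) : Prop :=
  feasible X S /\
  forall S' : nat -> {set T}, feasible X S' ->
    expected_profit S' 1 <= expected_profit S 1.

Definition offered (S : nat -> {set T}) (i : T) : Prop :=
  exists2 k : nat, (1 <= k <= W)%N & i \in S k.

(* K is the set of tiers whose candidate set receives m; K = pred1 k is the
   case of a single candidate set. *)
Definition add_product (m : T) (K : pred nat) (X : nat -> {set T}) :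
    nat -> {set T} :=
  fun k => if K k then m |: X k else X k.

(* The tiers in which m can be offered at all are those of K, so m can only be
   claimed to be offered if K has a tier from j on: if every tier of K is
   before j, the second conjunct says that m is not offered. *)
Definition offered_from_threshold (m : T) (K : pred nat)
    (S Shat : nat -> {set T}) : Prop :=
  forall j : nat, (2 <= j <= W)%N ->
    expected_profit S j < r m -> r m < expected_profit S j.-1 ->
    ((exists2 k : nat, (j <= k <= W)%N & K k) -> offered Shat m) /\
    (forall k : nat, (1 <= k <= j.-1)%N -> m \notin Shat k).

Definition not_offered_below_last (m : T) (S Shat : nat -> {set T}) : Prop :=
  r m < expected_profit S W -> ~ offered Shat m.

End SequentialMNL.

(* Main.v *)
(* By backward induction every suffix of an optimal recommendation is optimal,
   and tier k is a set A maximizing (\sum_A r_i v_i + c) / (1 + \sum_A v_i),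
   where c is the expected profit from tier k+1 on.  This value exceeds t iff
   \sum_A v_i (r_i - t) > t - c, so including m in tier k pays exactly when r_m
   exceeds the optimal profit from tier k on.  These profits decrease with k and
   can only grow when candidates are added, so they can be compared before and
   after the inclusion of m. *)

Require Import Defs.
From HB Require Import structures.
From mathcomp Require Import all_boot all_order all_algebra.

Set Implicit Arguments.
Unset Strict Implicit.
Unset Printing Implicit Defensive.

Import Order.TTheory GRing.Theory Num.Theory.

Local Open Scope ring_scope.

Section SequentialMNLTheory.

Variables (R : realFieldType) (T : finType) (W : nat) (v r : T -> R).
Hypothesis v_ge0 : forall i, 0 <= v i.

Implicit Types (X S : nat -> {set T}) (A B : {set T}) (c t : R) (j k : nat).

Local Notation profit := (expected_profit W v r).

(** * Value of one tier as a function of the profit from later tiers *)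

Definition tier_value A c : R :=
  (\sum_(i in A) r i * v i + c) / (1 + \sum_(i in A) v i).

Lemma total_weight_gt0 A : 0 < 1 + \sum_(i in A) v i.
Proof. by rewrite ltr_pwDl // sumr_ge0. Qed.

Lemma no_purchase_gt0 A : 0 < no_purchase v A.
Proof. by rewrite divr_gt0 ?total_weight_gt0. Qed.

Lemma tier_valueE A c : tier_value A c = tier_profit v r A + no_purchase v A * c.
Proof.
by rewrite /tier_value /tier_profit /no_purchase mulrDl mul1r [_^-1 * c]mulrC.
Qed.

Lemma tier_value0 c : tier_value set0 c = c.
Proof. by rewrite /tier_value !big_set0 add0r addr0 divr1. Qed.

Lemma ltr_tier_value A : {mono tier_value A : c c' / c < c'}.
Proof.
by move=> c c'; rewrite !tier_valueE ltrD2l ltr_pM2l ?no_purchase_gt0.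
Qed.

Lemma tier_surplusE A t :
  \sum_(i in A) v i * (r i - t) =
  \sum_(i in A) r i * v i - t * \sum_(i in A) v i.
Proof.
rewrite mulr_sumr -sumrB; apply: eq_bigr => i _.
by rewrite mulrBr [v i * r i]mulrC [v i * t]mulrC.
Qed.

Lemma lt_tier_value A c t :
  (t < tier_value A c) = (t - c < \sum_(i in A) v i * (r i - t)).
Proof.
rewrite ltr_pdivlMr ?total_weight_gt0 // tier_surplusE mulrDr mulr1.
by rewrite ltrBlDr addrAC ltrBrDr.
Qed.

(** At [t = tier_value A c] the inequality of [lt_tier_value] becomes an equality. Adding or
    removing one product then changes the left side by a single term, whose sign decides the
    comparison. *)
Lemma tier_surplus_value A c :
  \sum_(i in A) v i * (r i - tier_value A c) = tier_value A c - c.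
Proof.
have w0 : 1 + \sum_(i in A) v i != 0 by rewrite gt_eqF ?total_weight_gt0.
apply/eqP; rewrite tier_surplusE subr_eq addrAC eq_sym subr_eq.
by rewrite -{1}[tier_value A c]mulr1 -mulrDr divfK.
Qed.

Lemma tier_value_add_lt A c i : i \notin A -> 0 < v i ->
  tier_value A c < r i -> tier_value A c < tier_value (i |: A) c.
Proof.
move=> iA vi lt_ri; rewrite lt_tier_value big_setU1 //= tier_surplus_value.
by rewrite ltrDr mulr_gt0 ?subr_gt0.
Qed.

Lemma tier_value_remove_lt A c i : i \in A -> 0 < v i ->
  r i < tier_value A c -> tier_value A c < tier_value (A :\ i) c.
Proof.
move=> iA vi lt_ri; rewrite lt_tier_value -tier_surplus_value (big_setD1 i) //=.
by rewrite gtrDr pmulr_rlt0 // subr_lt0.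
Qed.

(** * Recursion of the expected profit over the tiers *)

Lemma expected_profit_rec S j : (j <= W)%N ->
  profit S j = tier_value (S j) (profit S j.+1).
Proof.
move=> jW; rewrite /expected_profit big_ltn ?ltnS // big_geq // mul1r.
rewrite tier_valueE mulr_sumr; congr (_ + _).
rewrite !big_nat; apply: eq_bigr => k /andP[jk _].
by rewrite big_ltn // mulrA.
Qed.

Lemma expected_profit_out S j : (W < j)%N -> profit S j = 0.
Proof. by move=> Wj; rewrite /expected_profit big_geq. Qed.

(** Tier values are compared instead of sets, so that recommendations differing only in a product of
    zero valuation are covered. *)
Lemma expected_profit_ext S S' j :
    (forall k c, (j <= k <= W)%N -> tier_value (S k) c = tier_value (S' k) c) ->
  profit S j = profit S' j.
Proof.
(* The recursion runs upwards in [j], hence induction on the number of remaining tiers. *)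
have [d] := ubnP (W.+1 - j); elim: d j => // d IHd j.
rewrite ltnS => led eqS; have [jW|Wj] := leqP j W; last first.
  by rewrite !expected_profit_out.
rewrite (expected_profit_rec S jW) (expected_profit_rec S' jW).
rewrite eqS ?leqnn // (IHd j.+1) //.
  by rewrite (leq_trans _ led) // subSS subSn.
by move=> k c /andP[jk kW]; apply: eqS; rewrite kW ltnW.
Qed.

(** Every tier is left without purchase with positive probability, so a strict gain from tier [j] on
    survives through the common tiers before it. *)
Lemma expected_profit_lt_prefix S S' i j :
    (i <= j)%N -> (j <= W.+1)%N ->
    (forall k, (i <= k < j)%N -> S k = S' k) ->
  profit S j < profit S' j -> profit S i < profit S' i.
Proof.
move=> + jW; have [d] := ubnP (j - i); elim: d i => // d IHd i led.
rewrite leq_eqVlt => /predU1P[-> //|ij] eqS lt_j.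
have iW : (i <= W)%N by rewrite -ltnS (leq_trans ij).
rewrite (expected_profit_rec S iW) (expected_profit_rec S' iW).
rewrite -eqS ?leqnn // ltr_tier_value.
apply: IHd => //; last first.
  by move=> k /andP[ik kj]; apply: eqS; rewrite kj ltnW.
by rewrite -ltnS (leq_ltn_trans _ led) // -subSn // subSS.
Qed.

(** * Consequences of optimality *)

Lemma optimal_suffix X S S' j : optimal W v r X S -> feasible W X S' ->
  (1 <= j <= W.+1)%N -> profit S' j <= profit S j.
Proof.
move=> [fS optS] fS' /andP[j1 jW]; rewrite leNgt; apply/negP => lt_j.
(* A better suffix, spliced onto the first tiers of [S], would beat [S] from tier 1. *)
pose S2 k := if (k < j)%N then S k else S' k.
have fS2 : feasible W X S2.
  by move=> k kW; rewrite /S2; case: ifP => _; [apply: fS | apply: fS'].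
have eq_j : profit S' j = profit S2 j.
  by apply: expected_profit_ext => k c /andP[jk _]; rewrite /S2 ltnNge jk.
have := optS S2 fS2; rewrite leNgt => /negP; apply.
apply: (expected_profit_lt_prefix j1 jW); last by rewrite -eq_j.
by move=> k /andP[_ kj]; rewrite /S2 kj.
Qed.

Lemma optimal_tier X S A k : optimal W v r X S -> (1 <= k <= W)%N ->
  A \subset X k -> tier_value A (profit S k.+1) <= profit S k.
Proof.
move=> optS /andP[k1 kW] AX.
pose S' l := if l == k then A else S l.
have fS' : feasible W X S'.
  by move=> l lW; rewrite /S'; case: eqP => [->//|_]; apply: optS.1.
have -> : tier_value A (profit S k.+1) = profit S' k.
  have S'k : S' k = A by rewrite /S' eqxx.
  rewrite (expected_profit_rec S' kW) S'k; congr tier_value.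
  apply: expected_profit_ext => l c /andP[kl _].
  by rewrite /S' gtn_eqF.
by apply: (optimal_suffix optS fS'); rewrite k1 leqW.
Qed.

Lemma optimal_profit_succ X S k : optimal W v r X S -> (1 <= k <= W)%N ->
  profit S k.+1 <= profit S k.
Proof.
(* Offering nothing in tier [k] is feasible and passes on the profit of the later tiers. *)
by move=> optS kW; rewrite -[leLHS]tier_value0 (optimal_tier optS) ?sub0set.
Qed.

Lemma optimal_profit_anti X S j k : optimal W v r X S ->
  (1 <= j)%N -> (j <= k)%N -> (k <= W)%N -> profit S k <= profit S j.
Proof.
move=> optS j1; elim: k => [|k IHk]; first by rewrite leqn0 => /eqP->.
rewrite leq_eqVlt => /predU1P[-> //|]; rewrite ltnS => jk kW.
apply: le_trans (IHk jk (ltnW kW)); apply: (optimal_profit_succ optS).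
by rewrite (leq_trans j1 jk) ltnW.
Qed.

Lemma optimal_notin X S i k : optimal W v r X S -> (1 <= k <= W)%N ->
  0 < v i -> r i < profit S k -> i \notin S k.
Proof.
move=> optS kW vi lt_ri; apply/negP => iS.
have kleW : (k <= W)%N by case/andP: kW.
have := optimal_tier optS kW (subset_trans (subD1set (S k) i) (optS.1 k kW)).
rewrite leNgt => /negP; apply.
by rewrite (expected_profit_rec S kleW) tier_value_remove_lt // -expected_profit_rec.
Qed.

Lemma optimal_in X S i k : optimal W v r X S -> (1 <= k <= W)%N ->
  i \in X k -> 0 < v i -> profit S k < r i -> i \in S k.
Proof.
move=> optS kW iX vi lt_ri; apply/negPn/negP => iS.
have kleW : (k <= W)%N by case/andP: kW.
have sub : i |: S k \subset X k by rewrite subUset sub1set iX optS.1.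
have := optimal_tier optS kW sub; rewrite leNgt => /negP; apply.
by rewrite (expected_profit_rec S kleW) tier_value_add_lt // -expected_profit_rec.
Qed.

Lemma optimal_of_tier_values X S S' : optimal W v r X S -> feasible W X S' ->
    (forall k c, tier_value (S' k) c = tier_value (S k) c) ->
  optimal W v r X S'.
Proof.
move=> [_ optS] fS' eqS; split=> // S2 fS2.
by rewrite (@expected_profit_ext S' S) ?optS.
Qed.

(** The product [i] contributes zero to both sums, so only the rest of each set counts. *)
Lemma tier_value_weightless A B c i : v i = 0 -> A :\ i = B :\ i ->
  tier_value A c = tier_value B c.
Proof.
move=> vi0 eqAB.
have sumD1 (C : {set T}) (F : T -> R) : F i = 0 ->
    \sum_(a in C) F a = \sum_(a in C :\ i) F a.
  move=> Fi; have [iC|iC] := boolP (i \in C).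
    by rewrite (big_setD1 i) //= Fi add0r.
  by rewrite (setDidPl _) // disjoint_sym disjoints1.
have drop (F : T -> R) : F i = 0 -> \sum_(a in A) F a = \sum_(a in B) F a.
  by move=> Fi; rewrite (sumD1 A) // (sumD1 B) // eqAB.
by rewrite /tier_value (drop v) // (drop (fun a => r a * v a)) // vi0 mulr0.
Qed.

Lemma feasible_add_product X S i K :
  feasible W X S -> feasible W (add_product i K X) S.
Proof.
move=> fS k kW; rewrite /add_product; case: ifP => _; last exact: fS.
exact: subset_trans (fS k kW) (subsetUr _ _).
Qed.

Lemma feasible_not_offered X S i K : feasible W (add_product i K X) S ->
  ~ offered W S i -> feasible W X S.
Proof.
move=> fS noffS k kW; have := fS k kW; rewrite /add_product.
case: ifP => // _; rewrite -subDset (setDidPl _) // disjoint_sym disjoints1.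
apply/negP => iS.
by apply: noffS; exists k.
Qed.

End SequentialMNLTheory.

Theorem proposition4p5 (R : realFieldType) (T : finType) (W : nat)
    (v r : T -> R) (X : nat -> {set T}) (m : T) (K : pred nat)
    (S Shat : nat -> {set T})
    (hW : (1 <= W)%N)
    (hv : forall i : T, 0 <= v i < 1)
    (hnew : forall k : nat, (1 <= k <= W)%N -> m \notin X k)
    (hK : exists2 k : nat, (1 <= k <= W)%N & K k)
    (hS : optimal W v r X S)
    (hShat : optimal W v r (add_product m K X) Shat) :
  (* 1 *)
  (forall j : nat, (1 <= j <= W.-1)%N ->
     expected_profit W v r Shat j >= expected_profit W v r Shat j.+1) /\
  (* 2 and 3; a product with v m = 0 is never bought, so it can be added to or
     removed from an optimal recommendation freely *)
  (0 < v m ->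
     offered_from_threshold W v r m K S Shat /\
     not_offered_below_last W v r m S Shat) /\
  (v m = 0 ->
     exists Shat0 : nat -> {set T},
       [/\ optimal W v r (add_product m K X) Shat0,
           offered_from_threshold W v r m K S Shat0 &
           not_offered_below_last W v r m S Shat0]).
Proof.
have v0 i : 0 <= v i by case/andP: (hv i).
(* [S] stays feasible after the inclusion of [m], so [Shat] does at least as well on every
   suffix. *)
have le_Shat k : (1 <= k <= W)%N ->
    expected_profit W v r S k <= expected_profit W v r Shat k.
  case/andP=> k1 kW; apply: (optimal_suffix v0 hShat); last by rewrite k1 leqW.
  exact/feasible_add_product/hS.1.
split.
  move=> j /andP[j1 jW]; apply: (optimal_profit_succ v0 hShat).
  by rewrite j1 (leq_trans jW (leq_pred _)).
split=> [vm|vm0].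
  have notin j k : r m < expected_profit W v r S j -> (1 <= k <= j)%N ->
      (j <= W)%N -> m \notin Shat k.
    move=> lt_m /andP[k1 kj] jW.
    have kW : (1 <= k <= W)%N by rewrite k1 (leq_trans kj).
    apply: (optimal_notin v0 hShat) => //; apply: lt_le_trans lt_m _.
    exact: le_trans (optimal_profit_anti v0 hS k1 kj jW) (le_Shat k kW).
  split; last by move=> lt_m [k kW]; apply/negP/(notin W).
  move=> j /andP[j2 jW] lt_jm lt_mj; split; last first.
    by move=> k kj; apply: (notin j.-1) => //; apply: leq_trans (leq_pred _) jW.
  case=> k /andP[jk kW] Kk.
  have k1W : (1 <= k <= W)%N by rewrite kW (leq_trans _ jk) // ltnW.
  have [mS|mS] := boolP (m \in Shat k); first by exists k.
  (* If [m] is offered nowhere, [Shat] is feasible for [X], so its profit from tier [k] on is at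
     most that of [S], hence below [r m]; then tier [k] would have to contain [m]. *)
  have [off|noff] := boolP (has (fun l => m \in Shat l) (iota 1 W)).
    by case/hasP: off => l; rewrite mem_iota add1n ltnS => lW; exists l.
  have noffP : ~ offered W Shat m.
    by case=> l lW mSl; case/hasP: noff; exists l; rewrite // mem_iota add1n.
  suff : m \in Shat k by rewrite (negbTE mS).
  apply: (optimal_in v0 hShat) => //.
    by rewrite /add_product Kk setU11.
  apply: le_lt_trans lt_jm.
  apply: (@le_trans _ _ (expected_profit W v r S k)).
    apply: (optimal_suffix v0 hS (feasible_not_offered hShat.1 noffP)).
    by case/andP: k1W => -> ?; rewrite leqW.
  exact: (optimal_profit_anti v0 hS (ltnW j2) jk kW).
pose Shat0 k := if K k && (expected_profit W v r S k < r m)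
  then m |: Shat k else Shat k :\ m.
have notin0 j k : r m < expected_profit W v r S j -> (1 <= k <= j)%N ->
    (j <= W)%N -> m \notin Shat0 k.
  move=> lt_m /andP[k1 kj] jW; rewrite /Shat0 ltNge.
  rewrite (le_trans (ltW lt_m)) ?(optimal_profit_anti v0 hS) //.
  by rewrite andbF setD11.
exists Shat0; split.
- apply: (optimal_of_tier_values hShat) => [k kW|k c].
    rewrite /Shat0; case: ifP => [/andP[Kk _]|_].
      by rewrite subUset hShat.1 // andbT sub1set /add_product Kk setU11.
    exact: subset_trans (subD1set _ _) (hShat.1 k kW).
  apply: (tier_value_weightless _ _ vm0); apply/setP => i.
  by rewrite /Shat0; case: ifP => _; rewrite !inE; case: eqP.
- move=> j /andP[j2 jW] lt_jm lt_mj; split; last first.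
    by move=> k kj; apply: (notin0 j.-1) => //; apply: leq_trans (leq_pred _) jW.
  case=> k /andP[jk kW] Kk; exists k; first by rewrite kW (leq_trans _ jk) // ltnW.
  rewrite /Shat0 Kk (le_lt_trans _ lt_jm) ?setU11 //.
  exact: (optimal_profit_anti v0 hS (ltnW j2) jk kW).
- by move=> lt_m [k kW]; apply/negP/(notin0 W).
Qed.
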